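(* There exists a universal constant $c>0$ such that for arbitrarily large values of $n$ there is a simple graph with $n$ vertices having the following property: for the random walk on this graph started at some vertex $x$, there is a time $t$ (a positive integer) for which $$\mathbf{P}_x(\mathcal{S}_t)\ge\frac{c\,n\sqrt{\log n}}{t}.$$
   Context: The random walk $\{X_t\}_{t\ge0}$ on a graph moves at each step to a uniformly random neighbor of the current vertex. $\mathbf{P}_x$ denotes the probability for the walk started at $X_0=x$. $\mathcal{S}_t$ denotes the event that the vertex visited at time $t$ was not visited at any earlier time, i.e. $X_t\notin\{X_0,\dots,X_{t-1}\}$. $\log$ is the natural logarithm. *)

(* Defs.v *)
From mathcomp Require Import all_boot all_order all_algebra.
From mathcomp Require Import reals exp.

Set Implicit Arguments.
Unset Strict Implicit.
Unset Printing Implicit Defensive.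

Import Order.TTheory GRing.Theory Num.Theory.
Local Open Scope ring_scope.

Definition simple_graph (T : finType) (e : rel T) : Prop :=
  symmetric e /\ irreflexive e.

Definition degree (T : finType) (e : rel T) (u : T) : nat :=
  #|[set v | e u v]|.

(* Isolated vertices, which have no neighbor to move to, are made absorbing so
   that the walk is a Markov chain on every graph.  A walk started at a
   non-isolated vertex of a simple graph never meets one. *)
Definition step_prob (R : realType) (T : finType) (e : rel T) (u v : T) : R :=
  if degree e u == 0%N then (v == u)%:R
  else if e u v then (degree e u)%:R^-1 else 0.

(* (X_0, ..., X_t) *)
Definition trajectory (T : finType) (t : nat) := {ffun 'I_t.+1 -> T}.

(* P_x (X_0 = w_0, ..., X_t = w_t) *)
Definition traj_prob (R : realType) (T : finType) (e : rel T) (x : T) (t : nat)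
    (w : trajectory T t) : R :=
  (w ord0 == x)%:R *
  \prod_(i < t) step_prob R e (w (widen_ord (leqnSn t) i)) (w (lift ord0 i)).

(* The probability under P_x of an event determined by X_0, ..., X_t. *)
Definition walk_prob (R : realType) (T : finType) (e : rel T) (x : T) (t : nat)
    (A : pred (trajectory T t)) : R :=
  \sum_(w : trajectory T t | A w) traj_prob R e x w.

(* The event S_t. *)
Definition new_vertex (T : finType) (t : nat) : pred (trajectory T t) :=
  fun w => [forall i : 'I_t, w ord_max != w (widen_ord (leqnSn t) i)].

(* Main.v *)
Require Import Defs.
From mathcomp Require Import all_boot all_order all_algebra.
From mathcomp Require Import reals exp.
From mathcomp Require Import ring lra zify.

Set Implicit Arguments.
Unset Strict Implicit.
Unset Printing Implicit Defensive.

Import Order.TTheory GRing.Theory Num.Theory.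
Local Open Scope ring_scope.

(* Stack levels 0..k, level i being a complete multipartite graph with 2^k + 1
   classes of 2^i vertices, and join consecutive levels only through their
   zeroth classes, the portals.  The walk needs about 4^k steps to leave a level
   and then moves up rather than down with odds 4 : 1, so the hitting time of
   level k is essentially a sum of k comparable independent terms: it has mean of
   order k 4^k and standard deviation of order sqrt k 4^k.  During the first
   4^k / 4 steps after that hitting time most steps discover a vertex of level k.
   By Chebyshev and pigeonhole some time t of order k 4^k therefore has
   P(S_t) of order 1 / sqrt k, while n is of order 4^k and n sqrt(log n) / t of
   order 1 / sqrt k. *)

(** * Discovery probabilities by first-step recursion *)

(* P_x (X_t \notin A :|: {X_0, ..., X_(t-1)}): the walk records its past in [A]. *)
Fixpoint new_prob (R : realType) (T : finType) (e : rel T) (t : nat)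
    (A : {set T}) (x : T) : R :=
  if t is t'.+1 then \sum_y step_prob R e x y * new_prob R e t' (x |: A) y
  else (x \notin A)%:R.

Lemma new_probS (R : realType) (T : finType) (e : rel T) t (A : {set T}) x :
  new_prob R e t.+1 A x = \sum_y step_prob R e x y * new_prob R e t (x |: A) y.
Proof. by []. Qed.

Definition traj_cons (T : finType) t (p : T * trajectory T t) :
    trajectory T t.+1 :=
  [ffun i => if unlift ord0 i is Some j then p.2 j else p.1].

Lemma traj_cons0 (T : finType) t (p : T * trajectory T t) :
  traj_cons p ord0 = p.1.
Proof. by rewrite ffunE unlift_none. Qed.

Lemma traj_consS (T : finType) t (p : T * trajectory T t) j :
  traj_cons p (lift ord0 j) = p.2 j.
Proof. by rewrite ffunE liftK. Qed.

Lemma traj_cons_bij (T : finType) t : bijective (@traj_cons T t).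
Proof.
exists (fun w : trajectory T t.+1 =>
  (w ord0, [ffun j : 'I_t.+1 => w (lift ord0 j)])) => [[x w]|w].
  rewrite traj_cons0; congr pair.
  by apply/ffunP => j; rewrite ffunE traj_consS.
apply/ffunP => i; case: (unliftP ord0 i) => [j ->|->].
  by rewrite traj_consS ffunE.
by rewrite traj_cons0.
Qed.

Lemma traj_prob_cons (R : realType) (T : finType) (e : rel T) (x y : T) t
    (w : trajectory T t) :
  traj_prob R e x (traj_cons (y, w)) =
  (y == x)%:R * \sum_z step_prob R e x z * traj_prob R e z w.
Proof.
rewrite /traj_prob big_ord_recl traj_cons0 /=.
case: eqP => [->|_]; last by rewrite !mul0r.
rewrite !mul1r.
have -> : widen_ord (leqnSn t.+1) ord0 = ord0 by apply/val_inj.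
rewrite traj_cons0 traj_consS /=.
rewrite (bigD1 (w ord0)) //= eqxx mul1r [X in _ = _ + X]big1 ?addr0; last first.
  move=> z /negPf zw; by rewrite eq_sym zw mul0r mulr0.
congr (_ * _); apply: eq_bigr => i _.
have -> : widen_ord (leqnSn t.+1) (lift ord0 i) =
  lift ord0 (widen_ord (leqnSn t) i) by apply/val_inj.
by rewrite !traj_consS.
Qed.

Lemma new_vertex_cons (T : finType) (x : T) t (w : trajectory T t) :
  new_vertex (traj_cons (x, w)) = (w ord_max != x) && new_vertex w.
Proof.
rewrite /new_vertex.
have -> : (ord_max : 'I_t.+2) = lift ord0 ord_max by apply/val_inj.
rewrite traj_consS.
have w0 : widen_ord (leqnSn t.+1) ord0 = ord0 by apply/val_inj.
have wS i : widen_ord (leqnSn t.+1) (lift ord0 i) =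
  lift ord0 (widen_ord (leqnSn t) i) by apply/val_inj.
apply/forallP/andP => [h|[h0 /forallP h] i].
  split; first by have := h ord0; rewrite w0 traj_cons0.
  by apply/forallP => i; have := h (lift ord0 i); rewrite wS traj_consS.
case: (unliftP ord0 i) => [j ->|->]; first by rewrite wS traj_consS.
by rewrite w0 traj_cons0.
Qed.

(** A trajectory splits into its first vertex [x] and the rest; that the last vertex differs from
    [x] becomes, for the rest, a condition of avoiding [x |: A]. *)
Lemma new_probE (R : realType) (T : finType) (e : rel T) t (A : {set T}) x :
  new_prob R e t A x =
  walk_prob R e x (fun w : trajectory T t => (w ord_max \notin A) && new_vertex w).
Proof.
elim: t A x => [|t IH] A x /=; rewrite /walk_prob.
  rewrite (eq_bigl (fun w : trajectory T 0 => w ord0 \notin A)); last first.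
    move=> w; rewrite (_ : ord_max = ord0); last by apply/val_inj.
    by rewrite /new_vertex [X in _ && X](_ : _ = true) ?andbT //;
       apply/forallP => -[].
  under eq_bigr do rewrite /traj_prob big_ord0 mulr1.
  rewrite big_mkcond (bigD1 [ffun=> x]) //= !ffunE eqxx big1 ?addr0.
    by case: ifP.
  move=> w wx; case: ifP => // _; case: eqP => // w0; case/eqP: wx.
  by apply/ffunP => i; rewrite ffunE ord1.
rewrite (reindex _ (onW_bij _ (@traj_cons_bij T t))) /=.
rewrite (eq_bigr (fun p => traj_prob R e x (traj_cons (p.1, p.2)))); last by case.
rewrite (eq_bigl (fun p => predT p.1 && ((traj_cons (p.1, p.2) ord_max \notin A) &&
  new_vertex (traj_cons (p.1, p.2))))); last by case.
rewrite -(pair_big_dep predT (fun y w => (traj_cons (y, w) ord_max \notin A) &&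
  new_vertex (traj_cons (y, w))) (fun y w => traj_prob R e x (traj_cons (y, w)))) /=.
rewrite [RHS](bigD1 x) //= [X in _ = _ + X]big1 ?addr0; last first.
  move=> y /negPf yx; apply: big1 => w _.
  by rewrite traj_prob_cons yx mul0r.
under [RHS]eq_bigr do rewrite traj_prob_cons eqxx mul1r.
rewrite exchange_big /=; apply: eq_bigr => y _.
rewrite IH /walk_prob big_distrr /=; apply: eq_bigl => w.
rewrite new_vertex_cons.
have -> : (ord_max : 'I_t.+2) = lift ord0 ord_max by apply/val_inj.
by rewrite traj_consS in_setU1 negb_or andbA [X in X && _]andbC.
Qed.

Lemma walk_prob_new (R : realType) (T : finType) (e : rel T) t x :
  walk_prob R e x (@new_vertex T t) = new_prob R e t set0 x.
Proof. by rewrite new_probE; apply: eq_bigl => w; rewrite inE. Qed.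

Lemma step_prob_ge0 (R : realType) (T : finType) (e : rel T) x y :
  0 <= step_prob R e x y.
Proof. by rewrite /step_prob; do 2?case: ifP => //; rewrite ?ler0n ?invr_ge0. Qed.

Lemma new_prob_ge0 (R : realType) (T : finType) (e : rel T) t (A : {set T}) x :
  0 <= new_prob R e t A x.
Proof.
elim: t A x => [|t IH] A x /=; first exact: ler0n.
by apply: sumr_ge0 => y _; rewrite mulr_ge0 ?step_prob_ge0.
Qed.

Lemma degreeE (R : realType) (T : finType) (e : rel T) x :
  (degree e x)%:R = \sum_y (e x y)%:R :> R.
Proof.
rewrite /degree -sum1_card natr_sum big_mkcond /=; apply: eq_bigr => y _.
by rewrite inE; case: (e x y).
Qed.

Lemma sum_step_prob (R : realType) (T : finType) (e : rel T) x (F : T -> R) :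
  (0 < degree e x)%N ->
  \sum_y step_prob R e x y * F y =
  (\sum_y (e x y)%:R * F y) / (\sum_y (e x y)%:R).
Proof.
move=> dx; rewrite -degreeE mulr_suml; apply: eq_bigr => y _.
rewrite /step_prob gtn_eqF //; case: (e x y); last by rewrite !mul0r.
by rewrite mul1r mulrC.
Qed.

(** * The layered graph and its transition averages *)

(* A vertex is a triple (level, (class, index within the class)). *)
Definition vert (k s : nat) := {i : 'I_k.+1 & ('I_s.+1 * 'I_(2 ^ i))%type}.

Definition lvl k s (x : vert k s) : nat := tag x.

Definition col k s (x : vert k s) : nat := (tagged x).1.

Definition portal k s (x : vert k s) : bool := col x == 0%N.

Definition adj k s : rel (vert k s) := fun x y =>
  ((lvl x == lvl y) && (col x != col y)) ||
  [&& portal x, portal y & (lvl y == (lvl x).+1) || (lvl x == (lvl y).+1)].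

Lemma adj_simple k s : simple_graph (@adj k s).
Proof.
split=> [x y|x]; rewrite /adj; last by rewrite !eqxx /= !ltn_eqF //= !andbF.
by rewrite eq_sym [col x == _]eq_sym andbCA [(lvl y == _.+1) || _]orbC.
Qed.

Lemma lvl_le k s (x : vert k s) : (lvl x <= k)%N.
Proof. by rewrite -ltnS /lvl. Qed.

Lemma sum_vert (R : realType) k s (F : nat -> nat -> R) :
  \sum_(y : vert k s) F (lvl y) (col y) =
  \sum_(i < k.+1) (2 ^ i)%:R * \sum_(b < s.+1) F i b.
Proof.
rewrite -(@sig_big_dep _ _ _ _ _ predT (fun _ => predT) (fun (i : 'I_k.+1) (p : 'I_s.+1 * 'I_(2 ^ i)) => F i p.1)) /=.
apply: eq_bigr => i _.
rewrite -(pair_big predT predT (fun (b : 'I_s.+1) (_ : 'I_(2 ^ i)) => F i b)) /=.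
rewrite mulr_sumr; apply: eq_bigr => b _.
by rewrite sumr_const card_ord mulr_natl.
Qed.

Lemma card_vert k s : #|{: vert k s}| = (s.+1 * (2 ^ k.+1).-1)%N.
Proof.
apply/eqP; rewrite -sum1_card.
rewrite -(@sig_big_dep _ _ _ _ _ predT (fun _ => predT) (fun (i : 'I_k.+1) (p : 'I_s.+1 * 'I_(2 ^ i)) => 1%N)) /=.
rewrite (eq_bigr (fun i : 'I_k.+1 => s.+1 * 2 ^ i)%N); last first.
  by move=> i _; rewrite sum1_card card_prod !card_ord.
by rewrite -big_distrr /= predn_exp mul1n.
Qed.

Lemma sum_delta (R : realType) k m (F : nat -> R) :
  \sum_(i < k.+1) (i == m :> nat)%:R * F i = (m <= k)%:R * F m.
Proof.
case: leqP => [mk|km]; last first.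
  rewrite mul0r big1 // => i _; case: eqP => [im|]; last by rewrite mul0r.
  by have := ltn_ord i; rewrite im ltnS leqNgt km.
rewrite (bigD1 (Ordinal (mk : (m < k.+1)%N))) //= eqxx big1 ?addr0 // => i.
by rewrite -val_eqE /= => /negPf ->; rewrite mul0r.
Qed.

(* Functions of the level and of being a portal are stable under the transition
   operator: the walk projects to a Markov chain. *)
Lemma sum_adj_portal (R : realType) k s (G : nat -> bool -> R) (x : vert k s) :
  portal x ->
  \sum_y (adj x y)%:R * G (lvl y) (portal y) =
  (2 ^ lvl x)%:R * (s%:R * G (lvl x) false + (lvl x < k)%:R * 2 * G (lvl x).+1 true
    + (0 < lvl x)%:R / 2 * G (lvl x).-1 true).
Proof.
move=> px; have xk := lvl_le x; move: (px) => /eqP cx; rewrite /portal.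
pose F i b := (((lvl x == i) && (0 != b)) || ((b == 0) &&
  ((i == (lvl x).+1) || (lvl x == i.+1))))%N%:R * G i (b == 0)%N.
transitivity (\sum_(y : vert k s) F (lvl y) (col y)).
  by apply: eq_bigr => y _; rewrite /adj px cx.
rewrite sum_vert.
pose H (i : nat) := (2 ^ i)%:R * s%:R * G i false.
pose K (i : nat) := (2 ^ i)%:R * G i true.
transitivity (\sum_(i < k.+1) ((i == lvl x :> nat)%:R * H i +
   ((i == (lvl x).+1 :> nat)%:R * K i +
   (0 < lvl x)%:R * ((i == (lvl x).-1 :> nat)%:R * K i)))).
  apply: eq_bigr => i _; rewrite big_ord_recl /F /= andbF /=.
  under eq_bigr => b _ do rewrite /bump add1n -[_.+1 == 0%N]/false /= andbT orbF.
  rewrite eqxx sumr_const card_ord -mulr_natr /H /K [lvl x == i]eq_sym.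
  (* At level 0 the predecessor [.-1] is 0 itself; the factor [0 < lvl x] removes this spurious
     lower level. *)
  have -> : ((i == (lvl x).+1 :> nat) || (lvl x == i.+1))%:R =
    (i == (lvl x).+1 :> nat)%:R + (0 < lvl x)%:R * (i == (lvl x).-1 :> nat)%:R :> R.
    case: (lvl x) => [|m] /=; first by rewrite mul0r addr0 orbF.
    rewrite mul1r eqSS [m == _]eq_sym.
    case: eqP => [->|_] /=; last by rewrite add0r.
    by rewrite gtn_eqF ?addr0 //; lia.
  by ring.
rewrite !big_split /= -mulr_sumr !sum_delta xk /H /K.
case: (lvl x) xk => [|m] xk /=.
  by rewrite !mul0r; case: (0 < k)%N; rewrite expn1 expn0; lra.
by rewrite (ltnW xk) !expnS !natrM /=; field.
Qed.

Lemma sum_adj_nonportal (R : realType) k s (G : nat -> bool -> R) (x : vert k s) :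
  ~~ portal x ->
  \sum_y (adj x y)%:R * G (lvl y) (portal y) =
  (2 ^ lvl x)%:R * (G (lvl x) true + (s%:R - 1) * G (lvl x) false).
Proof.
move=> px; have xk := lvl_le x.
pose F i b := ((lvl x == i) && (col x != b))%:R * G i (b == 0)%N.
transitivity (\sum_(y : vert k s) F (lvl y) (col y)).
  by apply: eq_bigr => y _; rewrite /adj (negPf px) /= orbF.
rewrite sum_vert.
pose H (i : nat) := (2 ^ i)%:R * (G i true + (s%:R - 1) * G i false).
transitivity (\sum_(i < k.+1) (i == lvl x :> nat)%:R * H i); last first.
  by rewrite sum_delta xk mul1r.
apply: eq_bigr => i _; rewrite /F /H eq_sym.
case: eqP => _ /=; last by rewrite mul0r big1 ?mulr0 // => b _; rewrite mul0r.
rewrite mul1r; congr (_ * _); rewrite big_ord_recl /=.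
move: px; rewrite /portal => px; rewrite px mul1r; congr (_ + _).
have cs : (col x < s.+1)%N by rewrite /col.
case: s x px cs {H F xk} => [|s] x px cs; first by move: cs; rewrite ltnS leqn0 (negPf px).
(* With class 0 split off, the other classes are renumbered from 0, so the excluded class of [x] has
   index [(col x).-1]. *)
transitivity (\sum_(b < s.+1) (G i false - (b == (col x).-1 :> nat)%:R * G i false)).
  apply: eq_bigr => b _; rewrite /bump /= add1n.
  case: (col x) px => // c _ /=; rewrite eqSS [c == _]eq_sym.
  by case: eqP => _ /=; rewrite ?mul0r ?mul1r ?subrr ?subr0.
rewrite sumrB sumr_const card_ord (sum_delta s (col x).-1 (fun _ => G i false)).
have -> : ((col x).-1 <= s)%N by lia.
by rewrite mul1r -mulr_natl; ring.
Qed.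

Lemma degree_portal (R : realType) k s (x : vert k s) : portal x ->
  (degree (@adj k s) x)%:R =
  (2 ^ lvl x)%:R * (s%:R + (lvl x < k)%:R * 2 + (0 < lvl x)%:R / 2) :> R.
Proof.
move=> px; rewrite degreeE; have := sum_adj_portal (fun _ _ => 1 : R) px.
by under eq_bigr do rewrite mulr1; move=> ->; rewrite !mulr1.
Qed.

Lemma degree_nonportal (R : realType) k s (x : vert k s) : ~~ portal x ->
  (degree (@adj k s) x)%:R = (2 ^ lvl x)%:R * s%:R :> R.
Proof.
move=> px; rewrite degreeE; have := sum_adj_nonportal (fun _ _ => 1 : R) px.
by under eq_bigr do rewrite mulr1; move=> ->; rewrite mulr1 addrC subrK.
Qed.

Lemma degree_ge (R : realType) k s (x : vert k s) :
  (2 ^ lvl x)%:R * s%:R <= (degree (@adj k s) x)%:R :> R.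
Proof.
case: (boolP (portal x)) => px; last by rewrite degree_nonportal.
rewrite degree_portal // -addrA ler_wpM2l ?ler0n // lerDl.
by do 2!case: (_ < _)%N => /=; lra.
Qed.

Lemma degree_gt0 k s (x : vert k s) : (0 < s)%N -> (0 < degree (@adj k s) x)%N.
Proof.
move=> s0; case: (boolP (portal x)) => px; rewrite /degree card_gt0; apply/set0Pn.
  exists (Tagged (fun i : 'I_k.+1 => ('I_s.+1 * 'I_(2 ^ i))%type) (ord_max, (tagged x).2)).
  rewrite inE /adj; have /eqP -> := px.
  by rewrite /lvl /= eqxx /col /= eq_sym -lt0n s0.
exists (Tagged (fun i : 'I_k.+1 => ('I_s.+1 * 'I_(2 ^ i))%type) (ord0, (tagged x).2)).
by rewrite inE /adj /lvl /= eqxx /col /= px.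
Qed.

Lemma mean_portal (R : realType) k s (G : nat -> bool -> R) (x : vert k s) :
  (0 < s)%N -> portal x ->
  \sum_y step_prob R (@adj k s) x y * G (lvl y) (portal y) =
  (s%:R * G (lvl x) false + (lvl x < k)%:R * 2 * G (lvl x).+1 true
    + (0 < lvl x)%:R / 2 * G (lvl x).-1 true) /
  (s%:R + (lvl x < k)%:R * 2 + (0 < lvl x)%:R / 2).
Proof.
move=> s0 px; rewrite sum_step_prob ?degree_gt0 // sum_adj_portal // -degreeE.
rewrite degree_portal // -mulf_div divff ?mul1r //.
by rewrite pnatr_eq0 -lt0n expn_gt0.
Qed.

Lemma mean_nonportal (R : realType) k s (G : nat -> bool -> R) (x : vert k s) :
  (0 < s)%N -> ~~ portal x ->
  \sum_y step_prob R (@adj k s) x y * G (lvl y) (portal y) =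
  (G (lvl x) true + (s%:R - 1) * G (lvl x) false) / s%:R.
Proof.
move=> s0 px; rewrite sum_step_prob ?degree_gt0 // sum_adj_nonportal // -degreeE.
rewrite degree_nonportal // -mulf_div divff ?mul1r //.
by rewrite pnatr_eq0 -lt0n expn_gt0.
Qed.

Lemma ler_mean (R : realType) (T : finType) (e : rel T) x (F G : T -> R) :
  (forall y, F y <= G y) ->
  \sum_y step_prob R e x y * F y <= \sum_y step_prob R e x y * G y.
Proof. by move=> FG; apply: ler_sum => y _; rewrite ler_wpM2l ?step_prob_ge0. Qed.

Lemma step_prob_le (R : realType) k s (x y : vert k s) : (0 < s)%N ->
  step_prob R (@adj k s) x y <= ((2 ^ lvl x)%:R * s%:R)^-1.
Proof.
move=> s0; rewrite /step_prob gtn_eqF ?degree_gt0 //.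
have d0 : 0 < (2 ^ lvl x)%:R * s%:R :> R by rewrite mulr_gt0 ?ltr0n ?expn_gt0.
case: ifP => _; last by rewrite invr_ge0 ltW.
by rewrite lef_pV2 ?degree_ge // posrE // (lt_le_trans d0) // degree_ge.
Qed.

(** * Discovery of vertices inside the top level *)

(* Each step from level k hits a given vertex with probability at most 4^-k; the
   last two terms bound the probability of leaving level k, which requires being
   at a portal. *)
Lemma new_prob_top (R : realType) k r (A : {set vert k (2 ^ k)}) x :
  (0 < k)%N -> lvl x = k ->
  1 - (r.+1 + #|A :&: [set y | lvl y == k]|)%:R / (2 ^ k)%:R ^+ 2
    - r.+1%:R / (2 * (2 ^ k)%:R ^+ 2) - (portal x)%:R / (2 * (2 ^ k)%:R)
  <= new_prob R (@adj k (2 ^ k)) r.+1 A x.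
Proof.
move=> k0; set top := [set y | _]; set s : R := (2 ^ k)%:R => xk.
have s0 : (0 < 2 ^ k)%N by rewrite expn_gt0.
have s1 : 1 <= s by rewrite ler1n.
have topU B y : (#|(y |: B) :&: top| <= #|B :&: top|.+1)%N.
  apply: leq_trans (_ : #|y |: (B :&: top)| <= _)%N.
    by apply/subset_leq_card/subsetP => z; rewrite !inE; case: (z == y).
  by rewrite cardsU1; case: (_ \notin _); rewrite ?add1n ?add0n.
elim: r A x xk => [|r IH] A x xk.
  rewrite new_probS.
  (* For the last step: stay in level k, and lose at most [s ^- 2] for each vertex of that level
     already visited. *)
  apply: (@le_trans _ _ (\sum_y step_prob R (@adj k _) x y * (lvl y == k)%:R
     - \sum_(y in (x |: A) :&: top) s ^- 2)).
    pose G (i : nat) (_ : bool) : R := (i == k)%:R.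
    rewrite sumr_const -mulr_natl.
    have cU : (#|(x |: A) :&: top|)%:R / s ^+ 2 <= (1 + #|A :&: top|)%:R / s ^+ 2.
      by rewrite ler_wpM2r ?invr_ge0 ?sqr_ge0 // ler_nat add1n topU.
    suff : 1 - (portal x)%:R / (2 * s) <=
        \sum_y step_prob R (@adj k _) x y * (lvl y == k)%:R.
      have : 0 <= 1 / (2 * s ^+ 2) by rewrite divr_ge0 // mulr_ge0 // sqr_ge0.
      by lra.
    case: (boolP (portal x)) => px.
      rewrite (mean_portal G) // /G xk eqxx ltnn k0 -/s [k.-1 == k]ltn_eqF ?prednK //=.
      rewrite ler_pdivlMr; last by lra.
      have -> : (1 - 1 / (2 * s)) * (s + 0 * 2 + 1 / 2) = s - 1 / (4 * s) by field; lra.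
      have : 0 <= 1 / (4 * s) by rewrite divr_ge0 //; lra.
      by lra.
    rewrite (mean_nonportal G) // /G xk eqxx -/s mul0r subr0 mulr1 addrC subrK divff //.
    by rewrite gt_eqF //; lra.
  rewrite lerBlDr -lerBlDl -sumrB [X in _ <= X]big_mkcond /=.
  apply: ler_sum => y _; rewrite -mulrBr !inE.
  case: (boolP (lvl y == k)) => yk; rewrite ?andbT ?andbF /=; last first.
    by rewrite mulr_ge0_le0 ?step_prob_ge0 // sub0r oppr_le0 ler0n.
  case: (boolP ((y == x) || (y \in A))) => yA /=; last by rewrite subrr mulr0.
  by rewrite subr0 mulr1 (le_trans (step_prob_le _ _ _ s0)) // xk -/s expr2.
rewrite new_probS.
set a := #|A :&: top|; pose C : R := 1 - (r.+1 + a.+1)%:R / s ^+ 2 - r.+1%:R / (2 * s ^+ 2).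
(* Continuations outside level k are bounded below by 0. *)
pose G (i : nat) (p : bool) := (i == k)%:R * (C - p%:R / (2 * s)).
apply: (@le_trans _ _ (\sum_y step_prob R (@adj k _) x y * G (lvl y) (portal y))); last first.
  apply: ler_mean => y; rewrite /G; case: eqP => yk; last by rewrite mul0r new_prob_ge0.
  rewrite mul1r; apply: le_trans (IH _ _ yk); rewrite lerD2r lerD2r lerD2l lerN2.
  by rewrite ler_wpM2r ?invr_ge0 ?sqr_ge0 // ler_nat leq_add2l topU.
have -> : 1 - (r.+2 + a)%:R / s ^+ 2 - r.+2%:R / (2 * s ^+ 2) = C - 1 / (2 * s ^+ 2).
  by rewrite /C addnS -addSn -[r.+2%:R]natr1; field; lra.
have C1 : C <= 1.
  have : 0 <= (r.+1 + a.+1)%:R / s ^+ 2 by rewrite divr_ge0 ?ler0n ?sqr_ge0.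
  have : 0 <= r.+1%:R / (2 * s ^+ 2) by rewrite divr_ge0 ?ler0n ?mulr_ge0 ?sqr_ge0.
  by rewrite /C; lra.
case: (boolP (portal x)) => px.
  (* From a portal the walk leaves level k with probability (1/2) / (s + 1/2), which is below 1 /
     (2s). *)
  rewrite mean_portal // xk ltnn k0 -/s /G eqxx [k.-1 == k]ltn_eqF ?prednK //=.
  rewrite ler_pdivlMr; last by lra.
  have e2 : 0 <= 1 / (2 * s ^+ 2) by rewrite divr_ge0 // mulr_ge0 // sqr_ge0.
  have -> : (C - 1 / (2 * s ^+ 2) - 1 / (2 * s)) * (s + 0 * 2 + 1 / 2) =
     C * s + C / 2 - 1 / 2 - (1 / (2 * s ^+ 2) * (3 / 2 * s + 1/ 2)) by field; lra.
  have : 0 <= 1 / (2 * s ^+ 2) * (3 / 2 * s + 1 / 2) by rewrite mulr_ge0 //; lra.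
  by lra.
(* The next vertex is a portal with probability 1/s, at a cost of 1 / (2s): this is exactly the loss
   1 / (2 s^2) per step. *)
rewrite mean_nonportal // xk -/s /G eqxx /= le_eqVlt; apply/orP; left; apply/eqP.
by field; lra.
Qed.

Lemma mean_cst (R : realType) (T : finType) (e : rel T) x :
  (0 < degree e x)%N -> \sum_y step_prob R e x y = 1.
Proof.
move=> dx; have := sum_step_prob (fun _ => 1 : R) dx.
under eq_bigr do rewrite mulr1; move=> ->.
under eq_bigr do rewrite mulr1; rewrite -degreeE divff //.
by rewrite pnatr_eq0 -lt0n.
Qed.

(** * Mean and variance of the hitting time of the top level *)

(* The expected time to climb from the portal of level i to that of level i + 1;
   the recursion is the Poisson equation for the hitting time of level k, and
   [height s k i] is the expectation of that time. *)
Fixpoint gap (R : realType) (s : R) (i : nat) : R :=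
  if i is i'.+1 then (s ^+ 2 + s + 5 / 2 + gap s i' / 2) / 2
  else (s ^+ 2 + s + 2) / 2.

(** The previous gap enters the recursion with coefficient 1/4, by the 4 : 1 drift, so gaps stay of
    order s^2 uniformly in the level. *)
Lemma gap_bounds (R : realType) (s : R) i : 2 <= s ->
  s ^+ 2 / 2 <= gap s i <= 2 * s ^+ 2.
Proof.
move=> s2; have ss : 2 * s <= s ^+ 2 by rewrite expr2 ler_wpM2r //; lra.
elim: i => [|i /andP[IH1 IH2]] /=; apply/andP; split; lra.
Qed.

Definition height (R : realType) (s : R) (k i : nat) : R :=
  \sum_(i <= j < k) gap s j.

Lemma height_recl (R : realType) (s : R) k i : (i < k)%N ->
  height s k i = gap s i + height s k i.+1.
Proof. by move=> ik; rewrite /height big_ltn. Qed.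

Lemma height_ge0 (R : realType) (s : R) k i : 2 <= s -> 0 <= height s k i.
Proof.
move=> s2; apply: sumr_ge0 => j _; case/andP: (gap_bounds j s2) => h _.
by apply: le_trans h; rewrite divr_ge0 ?sqr_ge0.
Qed.

Lemma height_ge (R : realType) (s : R) k : 2 <= s ->
  k%:R * (s ^+ 2 / 2) <= height s k 0.
Proof.
move=> s2; rewrite -[k in k%:R]subn0 mulr_natl -sumr_const_nat.
by apply: ler_sum => j _; case/andP: (gap_bounds j s2).
Qed.

(* A bound on E (tau - c)^2 for the hitting time tau of level k: the mean is off by
   [height - c], with an extra [s] steps to reach the portal, and the first
   summands bound the variance.  In a step both tau and c decrease by one. *)
Definition pot (R : realType) (s : R) (k : nat) (c : R) (i : nat) (p : bool) : R :=
  if p || (k <= i)%N then (k - i)%:R * (12 * s ^+ 4) + (height s k i - c) ^+ 2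
  else (k - i)%:R * (12 * s ^+ 4) + s ^+ 2 + (height s k i + s - c) ^+ 2.

Lemma pot_ge0 (R : realType) (s : R) k c i p : 0 <= pot s k c i p.
Proof.
by rewrite /pot; case: ifP => _; rewrite !addr_ge0 ?sqr_ge0 // mulr_ge0 ?ler0n //
   mulr_ge0 // exprn_even_ge0.
Qed.

(** Heights are nonnegative, so a very negative c alone forces a large squared offset. *)
Lemma pot_far (R : realType) (s : R) k c i p (d : R) : 2 <= s -> 0 <= d ->
  c <= - d -> d ^+ 2 <= pot s k c i p.
Proof.
move=> s2 d0 cd; have h0 := height_ge0 k i s2.
have s4 : 0 <= (k - i)%:R * (12 * s ^+ 4).
  by rewrite mulr_ge0 ?ler0n // mulr_ge0 // exprn_even_ge0.
have sq z : d <= z -> d ^+ 2 <= z ^+ 2 by move=> dz; rewrite ler_pXn2r ?nnegrE //; lra.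
rewrite /pot; case: ifP => _.
  have := sq (height s k i - c); lra.
have := sq (height s k i + s - c); have := sqr_ge0 s; lra.
Qed.

(** The potential is a supermartingale below level k: the recursion for [gap] cancels the terms
    linear in the offset from c, and the allowance 12 s^4 per level pays for the squared
    increments. *)
Lemma pot_mean (R : realType) k s (c : R) (x : vert k s) :
  (1 < s)%N -> (lvl x < k)%N ->
  \sum_y step_prob R (@adj k s) x y * pot s%:R k (c - 1) (lvl y) (portal y)
    <= pot s%:R k c (lvl x) (portal x).
Proof.
move=> s1 xk; have s0 := ltnW s1.
have s2 : 2 <= s%:R :> R by rewrite ler_nat.
case: (boolP (portal x)) => px; last first.
  rewrite mean_nonportal // /pot /= (leqNgt k) xk /=.
  set a := _ * (12 * _); set h := height _ _ _; set z : R := s%:R in s2 *.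
  rewrite ler_pdivrMr; last by lra.
  (* The wait for a portal is geometric with parameter 1/z and variance z^2 - z, which the summand
     z^2 of [pot] covers. *)
  rewrite -subr_ge0 [X in 0 <= X](_ : _ = z); first by lra.
  by ring.
rewrite mean_portal // /pot /= (leqNgt k) xk /=.
set z : R := s%:R in s2 *; set i := lvl x in xk *.
have zz : 2 * z <= z ^+ 2 by rewrite expr2 ler_wpM2r //; lra.
have z3 : 2 * z ^+ 3 <= z ^+ 4.
  by rewrite [z ^+ 4]exprS ler_wpM2r // exprn_ge0 //; lra.
have z24 : 4 * z ^+ 2 <= z ^+ 4.
  by have -> : z ^+ 4 = (z * z) * z ^+ 2 by [ring]; rewrite ler_wpM2r ?sqr_ge0 //; nra.
have z4 : 16 <= z ^+ 4 by nra.
have gapS j : 0 <= (gap z j - 1) <= 2 * z ^+ 2.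
  by case/andP: (gap_bounds j s2) => ? ?; apply/andP; split; lra.
have gap_sq j : (gap z j - 1) ^+ 2 <= 4 * z ^+ 4.
  have -> : 4 * z ^+ 4 = (2 * z ^+ 2) ^+ 2 by ring.
  by case/andP: (gapS j) => ? ?; rewrite ler_pXn2r ?nnegrE //; lra.
have gap_sq' j : (gap z j + 1) ^+ 2 <= 9 * z ^+ 4.
  have -> : 9 * z ^+ 4 = (3 * z ^+ 2) ^+ 2 by ring.
  by case/andP: (gapS j) => ? ?; rewrite ler_pXn2r ?nnegrE //; lra.
have kS : (k - i)%:R = (k - i.+1)%:R + 1 :> R by rewrite natr1 -subSn.
case: i xk kS => [|i] xk kS.
  rewrite mul0r mul0r !addr0 kS (height_recl _ xk).
  set a := (k - 1)%:R; set h := height z k 1.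
  rewrite ler_pdivrMr; last by lra.
  rewrite -subr_ge0 [X in 0 <= X](_ : _ = 24 * z ^+ 4 - z ^+ 3 - z * (z + 1) ^+ 2
    - 2 * (gap z 0 - 1) ^+ 2); last by rewrite /gap; field.
  have := gap_sq 0%N; nra.
have kS' : (k - i)%:R = (k - i.+2)%:R + 2 :> R by rewrite -natrD; congr (_%:R); lia.
rewrite /= mul1r kS kS' (height_recl _ (ltnW xk)) (height_recl _ xk).
set a := (k - i.+2)%:R; set h := height z k i.+2.
rewrite ler_pdivrMr; last by lra.
(* Moves up and down have weights 2 and 1/2, so the allowance released is (2 - 1/2) * 12 = 18 times
   z^4. The offset changes by z + 1 on entering a non-portal, [1 - gap z i.+1] going up and
   [gap z i + 1] going down. *)
rewrite -subr_ge0 [X in 0 <= X](_ : _ = 18 * z ^+ 4 - z ^+ 3 - z * (z + 1) ^+ 2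
    - 2 * (gap z i.+1 - 1) ^+ 2 - (gap z i + 1) ^+ 2 / 2); last by rewrite /=; field.
have := gap_sq i.+1; have := gap_sq' i; nra.
Qed.

(** * From the hitting time to a good time: Chebyshev and pigeonhole *)

(** Within 4^k / 4 steps the three losses in [new_prob_top] are at most 1/4, 1/8 and 1/4. *)
Lemma new_prob_burst (R : realType) k (A : {set vert k (2 ^ k)}) x t :
  (0 < k)%N -> lvl x = k -> A :&: [set y | lvl y == k] = set0 ->
  (0 < t)%N -> (4 * t <= (2 ^ k) ^ 2)%N ->
  1 / 4 <= new_prob R (@adj k (2 ^ k)) t A x.
Proof.
move=> k0 xk A0; case: t => // t _ tk.
apply: le_trans (new_prob_top R t A k0 xk); rewrite A0 cards0 addn0.
set s : R := (2 ^ k)%:R.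
have s2 : 2 <= s by rewrite ler_nat -{1}(expn1 2) leq_exp2l.
set u : R := t.+1%:R.
have ts : u / s ^+ 2 <= 1 / 4.
  rewrite ler_pdivrMr; last by rewrite exprn_gt0 //; lra.
  by move: tk; rewrite -(ler_nat R) natrM natrX -/s; lra.
have -> : u / (2 * s ^+ 2) = (u / s ^+ 2) / 2.
  by rewrite invfM mulrCA mulrC.
have p1 : (portal x)%:R / (2 * s) <= 1 / 4.
  rewrite ler_pdivrMr; last by lra.
  by case: (portal x) => /=; lra.
by lra.
Qed.

(* Chebyshev's inequality for the hitting time of level k, each value of which is
   followed by r times t at which new_prob_burst applies. *)
Lemma window_sum (R : realType) k r N (A : {set vert k (2 ^ k)}) x (c D : R) :
  (0 < k)%N -> (4 * r = (2 ^ k) ^ 2)%N -> 0 < D ->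
  A :&: [set y | lvl y == k] = set0 -> c + D + r%:R <= N%:R ->
  r%:R / 4 * (1 - pot (2 ^ k)%:R k c (lvl x) (portal x) / D ^+ 2) <=
  \sum_(0 <= t < N.+1) (`|t%:R - c| <= D + r%:R)%R%:R *
    new_prob R (@adj k (2 ^ k)) t A x.
Proof.
move=> k0 rk D0; set s : R := (2 ^ k)%:R.
have s2 : 2 <= s by rewrite ler_nat -{1}(expn1 2) leq_exp2l.
have D2 : 0 < D ^+ 2 by rewrite exprn_gt0.
have term_ge0 t B y (b : bool) : 0 <= b%:R * new_prob R (@adj k (2 ^ k)) t B y.
  by rewrite mulr_ge0 ?ler0n ?new_prob_ge0.
have trivial_bound (p : R) : D ^+ 2 <= p -> r%:R / 4 * (1 - p / D ^+ 2) <= 0.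
  move=> Dp; rewrite mulr_ge0_le0 ?divr_ge0 ?ler0n // subr_le0.
  by rewrite ler_pdivlMr // mul1r.
have top_case N0 B y (b : R) : lvl y = k -> B :&: [set y | lvl y == k] = set0 ->
    b + D + r%:R <= N0%:R ->
    r%:R / 4 * (1 - pot s k b (lvl y) (portal y) / D ^+ 2) <=
    \sum_(0 <= t < N0.+1) (`|t%:R - b| <= D + r%:R)%R%:R *
      new_prob R (@adj k (2 ^ k)) t B y.
  move=> yk B0 bN.
  (* At level k [pot] is b^2, so unless the bound is trivial |b| < D and the times 1, ..., r all lie
     in the window. *)
  have [Dp|pD] := lerP (D ^+ 2) (pot s k b (lvl y) (portal y)).
    by apply: le_trans (trivial_bound _ Dp) _; rewrite sumr_ge0.
  have bD : `|b| < D.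
    move: pD; rewrite yk /pot leqnn orbT subnn mul0r add0r /height big_geq // sub0r sqrrN.
    by rewrite -real_normK ?num_real // ltr_pXn2r ?nnegrE ?normr_ge0 // ltW.
  move: bD; rewrite ltr_norml => /andP[bD1 bD2].
  have rN : (r <= N0)%N by rewrite -(ler_nat R); lra.
  apply: (@le_trans _ _ (\sum_(1 <= t < r.+1) 1 / 4)).
    rewrite sumr_const_nat subSS subn0 -[X in _ <= X]mulr_natl div1r ler_piMr ?divr_ge0 ?ler0n //.
    by rewrite gerBl divr_ge0 ?pot_ge0 // ltW.
  rewrite [X in _ <= X]big_ltn // (@big_cat_nat _ _ _ r.+1 1 N0.+1) // addrCA -[X in X <= _]addr0.
  apply: lerD; last by apply: addr_ge0; [exact: term_ge0 | exact: sumr_ge0].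
  apply: ler_sum_nat => t /andP[t0 tr].
  have -> : `|t%:R - b| <= D + r%:R.
    have : t%:R <= r%:R :> R by rewrite ler_nat.
    by rewrite ler_norml => ?; have := ler0n R t; lra.
  by rewrite [leRHS]mul1r new_prob_burst // -rk leq_mul2l.
elim: N A x c => [|N IH] A x c A0 cN; have := lvl_le x;
  rewrite leq_eqVlt => /orP[/eqP xk|xk]; try exact: top_case.
  (* Here N = 0 and the walk is below level k: c <= - D - r makes the left side nonpositive. *)
  apply: le_trans (_ : 0 <= _); last by rewrite sumr_ge0.
  by apply/trivial_bound/pot_far => //; have := ler0n R r; lra.
have s0 : (0 < 2 ^ k)%N by rewrite expn_gt0.
(* Time 0 is dropped; after one step the window is centred at c - 1. *)
rewrite big_nat_recl // ler_wpDl //.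
under eq_bigr do rewrite new_probS mulr_sumr.
rewrite exchange_big /=.
under eq_bigr do under eq_bigr do rewrite mulrCA.
under eq_bigr do rewrite -mulr_sumr.
pose G (y : vert k (2 ^ k)) := r%:R / 4 * (1 - pot s k (c - 1) (lvl y) (portal y) / D ^+ 2).
apply: (@le_trans _ _ (\sum_y step_prob R (@adj k (2 ^ k)) x y * G y)).
  have -> : \sum_y step_prob R (@adj k (2 ^ k)) x y * G y =
    r%:R / 4 * (1 - (\sum_y step_prob R (@adj k (2 ^ k)) x y *
      pot s k (c - 1) (lvl y) (portal y)) / D ^+ 2).
    rewrite -[X in X - _](mean_cst R (degree_gt0 x s0)) mulr_suml -sumrB mulr_sumr.
    by apply: eq_bigr => y _; rewrite /G; ring.
  rewrite ler_wpM2l ?divr_ge0 ?ler0n // lerD2l lerN2 ler_wpM2r ?invr_ge0 ?(ltW D2) //.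
  by rewrite pot_mean // -{1}(expn0 2) ltn_exp2l.
apply: ler_mean => y.
(* Recording [x], which lies below level k, leaves level k unvisited. *)
have xA0 : (x |: A) :&: [set y | lvl y == k] = set0.
  apply/setP => z; have /setP/(_ z) := A0; rewrite !inE.
  by have [->|_] := eqVneq z x; rewrite ?(ltn_eqF xk) ?andbF.
apply: le_trans (IH _ y (c - 1) xA0 _) _; first by move: cN; rewrite -natr1; lra.
apply: ler_sum => t _; rewrite -natr1.
by rewrite (_ : t%:R + 1 - c = t%:R - (c - 1)) //; ring.
Qed.

(** The window fits in 2E + 2 consecutive integers, and the value reached is half the resulting
    average. Only a lower bound on t is kept, since the target bound decreases in t. *)
Lemma window_pigeonhole (R : realType) (f : nat -> R) (c S : R) (E : nat) :
  0 < S -> E%:R <= c ->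
  (forall N, c + E%:R <= N%:R ->
    S <= \sum_(0 <= t < N.+1) (`|t%:R - c| <= E%:R)%R%:R * f t) ->
  exists2 t : nat, c - E%:R <= t%:R & S / (4 * (E%:R + 1)) <= f t.
Proof.
move=> S0 Ec fS; set m := Num.truncn (c - E%:R).
have /andP[m1 m2] : m%:R <= c - E%:R < m.+1%:R by apply: truncn_itv; rewrite subr_ge0.
(* As c - E < m + 1, the range from m to N covers the window. *)
pose N := (m + E.*2.+1)%N.
have cN : c + E%:R <= N%:R by rewrite /N addnS -addSn natrD -muln2 natrM; lra.
have {}fS := fS _ cN.
have E0 : 0 <= E%:R :> R := ler0n _ _.
set th := S / _.
have th0 : 0 <= th by rewrite divr_ge0 ?ltW //; lra.
case: (boolP [exists t : 'I_N.+1, (c - E%:R <= t%:R) && (th <= f t)]) => [|h].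
  by case/existsP => t /andP[? ?]; exists t.
have small t : (t < N.+1)%N -> c - E%:R <= t%:R -> f t <= th.
  move=> tN ct; move/existsPn: h => /(_ (Ordinal tN)) /=.
  by rewrite ct /= -ltNge => /ltW.
have : \sum_(0 <= t < N.+1) (`|t%:R - c| <= E%:R)%R%:R * f t <= (N.+1 - m)%:R * th.
  rewrite (@big_cat_nat _ _ _ m 0 N.+1) //=; last by rewrite /N; lia.
  rewrite big_nat_cond big1 ?add0r; last first.
    move=> t /andP[/andP[_ tm] _].
    rewrite ler_norml [X in X && _](_ : _ = false) ?mul0r //; apply/negbTE.
    by move: tm; rewrite -(ler_nat R) -natr1 -ltNge => ?; lra.
  rewrite mulr_natl -sumr_const_nat; apply: ler_sum_nat => t /andP[_ tN].
  case: (boolP (`|t%:R - c| <= E%:R)) => /=; last by rewrite mul0r.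
  by rewrite mul1r ler_norml => /andP[? _]; apply: small => //; lra.
have -> : (N.+1 - m)%N = (E.*2 + 2)%N by rewrite /N; lia.
have -> : (E.*2 + 2)%:R * th = S / 2.
  by rewrite natrD -muln2 natrM /th; field; lra.
by move=> ?; exfalso; lra.
Qed.

(** * Choice of parameters and the final bound *)

(** For k = q^2, log n <= (k + 1) log 4 <= 4 (q^2 + 1) <= 9 q^2. *)
Lemma sqrt_ln_card (R : realType) (q k n : nat) : (0 < q)%N -> k = (q ^ 2)%N ->
  (0 < n <= 4 ^ k.+1)%N -> Num.sqrt (ln n%:R) <= 3 * q%:R :> R.
Proof.
move=> q0 kq /andP[n0 n4].
have -> : 3 * q%:R = Num.sqrt ((3 * q%:R) ^+ 2) :> R.
  by rewrite sqrtr_sqr ger0_norm // mulr_ge0 ?ler0n.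
apply: ler_wsqrtr; apply: (@le_trans _ _ (ln ((4 : R) ^+ k.+1))).
  by rewrite ler_ln ?posrE ?exprn_gt0 ?ltr0n // -natrX ler_nat.
rewrite lnXn // -[leLHS]mulr_natr.
have l4 : ln (4 : R) <= 4 by rewrite ltW // ln_sublinear.
have q1 : 1 <= q%:R :> R by rewrite ler1n.
rewrite -[k.+1%:R]natr1 kq natrX; apply: (@le_trans _ _ (4 * (q%:R ^+ 2 + 1))).
  by rewrite ler_wpM2r // addr_ge0 ?sqr_ge0.
by nra.
Qed.

Theorem claim5p2 (R : realType) :
  exists c : R, 0 < c /\
    forall N : nat, exists n : nat, (N <= n)%N /\
      exists (T : finType) (e : rel T),
        [/\ #|T| = n, simple_graph e &
          exists (x : T) (t : nat), (0 < t)%N /\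
            c * n%:R * Num.sqrt (ln n%:R) / t%:R
              <= walk_prob R e x (@new_vertex T t)].
Proof.
(* The final comparison needs 16 * 3 / 40000 <= 1 / 800. *)
exists 40000%:R^-1; split=> [|N]; first by rewrite invr_gt0 ltr0n.
(* q >= 21 gives (20 q + 1) r <= q^2 r, so the window around c >= 2 q^2 r starts after q^2 r; r is
   4^k / 4. *)
pose q := maxn N 21; pose k := (q ^ 2)%N; pose r := (4 ^ k.-1)%N.
have q21 : (21 <= q)%N by rewrite leq_maxr.
have q0 : (0 < q)%N by apply: leq_trans q21.
have k0 : (0 < k)%N by rewrite expn_gt0 q0.
have rk : (4 * r = (2 ^ k) ^ 2)%N.
  by rewrite -expnS prednK // -expnM mulnC expnM.
have r0 : (0 < r)%N by rewrite expn_gt0.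
pose n := #|{: vert k (2 ^ k)}|.
have nE : n = ((2 ^ k).+1 * (2 ^ k.+1).-1)%N := card_vert _ _.
have n4 : (0 < n <= 4 * (2 ^ k) ^ 2)%N.
  rewrite nE expnS; have : (0 < 2 ^ k)%N by rewrite expn_gt0.
  move: (2 ^ k)%N => z z0; nia.
have nN : (N <= n)%N.
  apply: leq_trans (_ : q <= _)%N; first exact: leq_maxl.
  apply: leq_trans (_ : k <= _)%N; first by rewrite /k; nia.
  apply: leq_trans (_ : 2 ^ k <= _)%N; first by rewrite ltnW // ltn_expl.
  rewrite nE expnS; have : (0 < 2 ^ k)%N by rewrite expn_gt0.
  move: (2 ^ k)%N => z z0; nia.
exists n; split=> //; exists (vert k (2 ^ k)), (@adj k (2 ^ k)).
split=> //; first exact: adj_simple.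
have z0 : (0 < 2 ^ 0)%N by [].
pose x : vert k (2 ^ k) := Tagged (fun i : 'I_k.+1 => ('I_(2 ^ k).+1 * 'I_(2 ^ i))%type)
  (ord0, Ordinal z0 : 'I_(2 ^ (ord0 : 'I_k.+1))).
(* At the starting portal of level 0 this c cancels the squared term of [pot], leaving 12 k s^4 =
   192 (q r)^2, at most half of D^2 = 400 (q r)^2. *)
pose s : R := (2 ^ k)%:R; pose c := height s k 0; pose D := (20 * q * r)%N.
have s2 : 2 <= s by rewrite ler_nat -{1}(expn1 2) leq_exp2l.
have ss : s ^+ 2 = 4 * r%:R by rewrite -natrX -rk natrM.
have kqR : k%:R = q%:R ^+ 2 :> R by rewrite natrX.
have qR : 21 <= q%:R :> R by rewrite ler_nat.
have rR : 1 <= r%:R :> R by rewrite ler1n.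
have DR : D%:R = 20 * q%:R * r%:R :> R by rewrite !natrM.
have cge : 2 * q%:R ^+ 2 * r%:R <= c.
  by have := height_ge k s2; rewrite -/c ss kqR; lra.
have qr : 21 * r%:R <= q%:R * r%:R :> R by rewrite ler_wpM2r ?ler0n.
have qqr : 21 * (q%:R * r%:R) <= q%:R ^+ 2 * r%:R :> R.
  by rewrite expr2 -mulrA ler_wpM2r // mulr_ge0 ?ler0n.
have [|||t tc ft] := @window_pigeonhole R (fun t => new_prob R (@adj k (2 ^ k)) t set0 x)
    c (r%:R / 8) (D + r).
- by rewrite divr_gt0 ?ltr0n.
- by rewrite natrD DR; lra.
- move=> N0; rewrite natrD addrA => cN.
  have D0 : 0 < D%:R :> R by rewrite DR; lra.
  apply: le_trans (window_sum x k0 rk D0 (set0I _) cN).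
  have -> : r%:R / 8 = r%:R / 4 * (1 / 2) :> R by field.
  rewrite ler_wpM2l ?divr_ge0 ?ler0n //.
  suff : pot s k c (lvl x) (portal x) / D%:R ^+ 2 <= 1 / 2 by lra.
  rewrite ler_pdivrMr ?exprn_gt0 // /pot /= /lvl /= subn0 -/c subrr expr0n addr0.
  have -> : s ^+ 4 = (s ^+ 2) ^+ 2 by rewrite -exprM.
  rewrite ss kqR DR; have : 0 <= (q%:R * r%:R) ^+ 2 :> R by exact: sqr_ge0.
  by lra.
have qrt : q%:R ^+ 2 * r%:R <= t%:R :> R by move: tc; rewrite natrD DR => ?; lra.
have qr0 : 0 < q%:R ^+ 2 * r%:R :> R by lra.
exists x, t; split; first by rewrite -(ltr0n R); lra.
rewrite walk_prob_new; apply: le_trans ft.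
have nk : (0 < n <= 4 ^ k.+1)%N 
  by rewrite expnS (_ : (4 ^ k = (2 ^ k) ^ 2)%N) // -expnM mulnC expnM.
have sq := sqrt_ln_card R q0 erefl nk.
have q1 : 0 < q%:R :> R by lra.
(* The pigeonhole value is r / (32 (20 q r + r + 1)), and 32 (r + 1) <= 160 q r. *)
apply: (@le_trans _ _ (1 / (800 * q%:R))); last first.
  rewrite ler_pdivlMr; last by rewrite mulr_gt0 // ltr_wpDl // ler0n.
  rewrite mul1r ler_pdivrMl ?mulr_gt0 // natrD DR.
  by lra.
have nR : n%:R <= 16 * r%:R :> R.
  by case/andP: n4 => _; rewrite -rk mulnA -(ler_nat R) natrM.
apply: (@le_trans _ _ (40000%:R^-1 * (16 * r%:R) * (3 * q%:R) / (q%:R ^+ 2 * r%:R))).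
  apply: ler_pM; rewrite ?mulr_ge0 ?invr_ge0 ?ler0n ?sqrtr_ge0 //.
    by rewrite ler_pM ?mulr_ge0 ?invr_ge0 ?ler0n ?sqrtr_ge0 // ler_wpM2l ?invr_ge0 ?ler0n.
  by rewrite lef_pV2 // posrE (lt_le_trans qr0).
rewrite ler_pdivrMr //.
have -> : 1 / (800 * q%:R) * (q%:R ^+ 2 * r%:R) = q%:R * r%:R / 800 :> R.
  by move: q1; move: (q%:R : R) (r%:R : R) => a b a0; field; rewrite gt_eqF.
by lra.
Qed.
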